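(* Let $n\ge1$, let $T\ne T'$ be distinct stable trees on the leaf set $S=\{a,b,c,1,\ldots,n\}$, and let $1\le i\le n$. Then the sets $\mathrm{slide}_i(T)$ and $\mathrm{slide}_i(T')$ are disjoint.
   Context: A stable tree on a leaf set $L$ is a tree whose leaves are bijectively labeled by $L$, with no vertex of degree $2$ and at least one vertex of degree $\ge 3$ (trees are considered up to label-preserving isomorphism). Labels are ordered $a<b<c<1<\cdots<n$. Slides. Let $v_i$ be the internal vertex of $T$ adjacent to leaf $i$. The branches of $T$ at $i$ are the connected components of $T\setminus\{v_i\}$ other than the leaf $i$; the root of a branch is its vertex adjacent to $v_i$. Let $\mathrm{Br}_a$ be the branch containing $a$, $e_a$ the edge joining $\mathrm{Br}_a$ to $v_i$, $m$ the minimal leaf label of $T\setminus(\mathrm{Br}_a\cup\{i\})$, and $\mathrm{Br}_m$ the branch containing $m$. An $i$-slide on $T$: add a vertex $\overline{v}$ in the middle of $e_a$, move $\mathrm{Br}_m$ so that its root is attached to $\overline{v}$, and attach each remaining branch (other than $\mathrm{Br}_a$, $\mathrm{Br}_m$) to either $v_i$ or $\overline{v}$. $\mathrm{slide}_i(T)$ is the set of stable trees so obtained (stability forces at least one branch to remain at $v_i$; so $\mathrm{slide}_i(T)=\emptyset$ if $\deg v_i=3$). *)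

(* Defs.v *)
From HB Require Import structures.
From mathcomp Require Import all_boot.

Set Implicit Arguments.
Unset Strict Implicit.
Unset Printing Implicit Defensive.

(* The labels a < b < c < 1 < ... < n are encoded as 0 < 1 < 2 < 3 < ... < n+2,
   so that the order of labels is the order of the underlying naturals. *)
Definition label (n : nat) : finType := 'I_n.+3.
Definition label_a {n : nat} : label n := ord0.
Definition label_num {n : nat} (i : nat) : label n := inord i.+2.

Record lgraph (n : nat) := LGraph {
  vertex : finType;
  edge : rel vertex;
  leaf : label n -> vertex
}.
Arguments edge {n} G x y : rename.
Arguments leaf {n} G k : rename.

Section LabelledGraphs.
Variables (n : nat) (G : lgraph n).
Implicit Types (x y v : vertex G) (i m : label n).

Definition neighbours x : {set vertex G} := [set y | edge G x y].
Definition degree x : nat := #|neighbours x|.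

Definition is_tree : Prop :=
  [/\ symmetric (edge G), irreflexive (edge G),
      forall x y, connect (edge G) x y
    & forall s : seq (vertex G), ucycle (edge G) s -> size s < 3].

Definition stable : Prop :=
  [/\ is_tree,
      injective (leaf G),
      forall x, degree x = 1 <-> exists k, leaf G k = x,
      forall x, degree x != 2
    & exists x, 3 <= degree x].

Definition edge_avoiding v : rel (vertex G) :=
  [rel x y | [&& edge G x y, x != v & y != v]].

(* The connected component of x in G \ {v}, for x != v. *)
Definition component v x : {set vertex G} :=
  [set y | y != v & connect (edge_avoiding v) x y].

Definition branches v i : {set {set vertex G}} :=
  [set component v x | x in [set~ v]] :\ [set leaf G i].

Definition is_minimal_label (P : pred (label n)) m : Prop :=
  P m /\ forall k, P k -> m <= k.

(* y is the root of one of the branches in B. *)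
Definition is_root_in v (B : {set {set vertex G}}) y : bool :=
  edge G v y && [exists C in B, y \in C].

(* The new vertex is None; the branches in B, attached to v in G, are attached
   to None, which is joined to v.  Subdividing e_a amounts to having Br_a in B.
 *)
Definition slide_edge v (B : {set {set vertex G}}) : rel (option (vertex G)) :=
  fun p q => match p, q with
  | None, None => false
  | None, Some x | Some x, None => (x == v) || is_root_in v B x
  | Some x, Some y =>
      [&& edge G x y, ~~ ((x == v) && is_root_in v B y)
        & ~~ ((y == v) && is_root_in v B x)]
  end.

Definition slide_graph v (B : {set {set vertex G}}) : lgraph n :=
  @LGraph n (option (vertex G)) (slide_edge v B) (fun k => Some (leaf G k)).

End LabelledGraphs.

Definition isomorphic (n : nat) (G H : lgraph n) : Prop :=
  exists f : vertex G -> vertex H,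
    [/\ bijective f,
        forall x y, edge H (f x) (f y) = edge G x y
      & forall k, f (leaf G k) = leaf H k].

Record stable_tree (n : nat) := StableTree {
  tree_graph :> lgraph n;
  tree_stable : stable tree_graph
}.

(* X belongs to slide_i(T), as sets of stable trees up to isomorphism.  Here v
   is v_i and B is the set of branches attached to the new vertex.  The choices
   of B whose slide_graph is unstable are discarded since X is stable. *)
Definition slide (n : nat) (i : label n) (T X : stable_tree n) : Prop :=
  exists (v : vertex T) (m : label n) (B : {set {set vertex T}}),
    let Br_a := component v (leaf T label_a) in
    let Br_m := component v (leaf T m) in
    [/\ edge T (leaf T i) v,
        is_minimal_label (fun k => (k != i) && (leaf T k \notin Br_a)) m,
        B \subset branches v i,
        (Br_a \in B) && (Br_m \in B)
      & isomorphic (slide_graph v B) X].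

(* Main.v *)
Require Import Defs.
From mathcomp Require Import all_boot.

(** A slide can be undone knowing only its result and the label [i].  In a
    result [X] of an [i]-slide on [T], the vertex [v_i] is the neighbour of the
    leaf [i] ([slide_neighbour_leaf]): the leaf [i] is not one of the branches
    moved to the new vertex, so it stays where it was.  The new vertex is the
    neighbour of [v_i] in the direction of the leaf [a]
    ([slide_neighbour_towards]), because [Br_a] is moved to the new vertex and
    removing [v_i] separates what hangs from the new vertex from the rest.
    Finally, [T] is obtained from [X] by contracting the edge between these two
    vertices ([slide_contraction]).

    Each of the three descriptions is invariant under isomorphism.  Hence an
    isomorphism between results of [i]-slides on [T] and on [T'] matches the
    vertices [v_i] and the new vertices, and therefore induces an isomorphism
    between the contractions [T] and [T']. *)

Set Implicit Arguments.
Unset Strict Implicit.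
Unset Printing Implicit Defensive.

(** * Isomorphisms of labelled graphs *)

Lemma isomorphic_sym n (G H : lgraph n) : isomorphic G H -> isomorphic H G.
Proof.
move=> [f [[g fK gK] fE fL]]; exists g; split; first by exists f.
- by move=> x y; rewrite -fE !gK.
- by move=> k; rewrite -fL fK.
Qed.

Lemma isomorphic_trans n (G H K : lgraph n) :
  isomorphic G H -> isomorphic H K -> isomorphic G K.
Proof.
move=> [f [bf fE fL]] [g [bg gE gL]]; exists (g \o f); split.
- exact: bij_comp.
- by move=> x y; rewrite /= gE fE.
- by move=> k; rewrite /= fL gL.
Qed.

Lemma connect_avoiding_image n (G H : lgraph n) (f : vertex G -> vertex H) v :
    injective f -> (forall x y, edge H (f x) (f y) = edge G x y) ->
  forall x y, connect (edge_avoiding v) x y ->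
    connect (edge_avoiding (f v)) (f x) (f y).
Proof.
move=> f_inj fE x _ /connectP[p xp ->].
elim: p x xp => [|z p IHp] x /=; first by rewrite connect0.
case/andP=> xz /IHp; apply: connect_trans; apply: connect1.
by rewrite /edge_avoiding /= fE !(inj_eq f_inj).
Qed.

(** * Components of the complement of a vertex *)

Section Components.
Variables (n : nat) (G : lgraph n).
Hypothesis G_sym : symmetric (edge G).
Implicit Types x y z v : vertex G.

Lemma edge_avoiding_connect_sym v : connect_sym (@edge_avoiding n G v).
Proof.
apply: sym_connect_sym => x y.
by rewrite /edge_avoiding /= G_sym [(x != v) && _]andbC.
Qed.

Lemma component_step v x y z :
  y \in component v x -> edge G y z -> z != v -> z \in component v x.
Proof.
rewrite !inE => /andP[yv xy] yz zv; rewrite zv /=.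
by apply: connect_trans xy (connect1 _); rewrite /edge_avoiding /= yz yv.
Qed.

Lemma component_eq v x y : y \in component v x -> component v x = component v y.
Proof.
rewrite inE => /andP[_ xy]; apply/setP=> z; rewrite !inE.
by rewrite (same_connect (@edge_avoiding_connect_sym v) xy).
Qed.

Lemma component_pendant v x :
  edge G x v -> degree x = 1 -> x != v -> component v x = [set x].
Proof.
move=> xv dx x_v; have [w xE] : exists w, neighbours x = [set w].
  by apply/cards1P/eqP.
have nbr y : edge G x y -> y = v.
  by move=> xy; have := xv; have := xy; rewrite -!(in_set (edge G x))
    -!/(neighbours _) xE !inE => /eqP-> /eqP->.
apply/setP=> y; rewrite !inE; apply/andP/eqP=> [[_]|->]; last first.
  by rewrite x_v connect0.
case/connectP=> -[|z p] //=; rewrite /edge_avoiding /=.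
by case/andP=> /and3P[/nbr-> _]; rewrite eqxx.
Qed.

(** A walk from [x] to [v] passes through a neighbour of [v] just before its
    first visit to [v]. *)
Lemma component_root v x : connect (edge G) x v -> x != v ->
  exists2 r, r \in component v x & edge G v r.
Proof.
case/connectP=> p xp pv; elim: p x xp pv => [|y p IHp] x /=.
  by move=> _ ->; rewrite eqxx.
case/andP=> xy yp pv x_v; have [yv|y_v] := eqVneq y v.
  by exists x; rewrite ?inE ?x_v ?connect0 // G_sym -yv.
have [r ry vr] := IHp y yp pv y_v; exists r => //.
have xy' : y \in component v x.
  by apply: component_step xy y_v; rewrite inE x_v connect0.
by rewrite (component_eq xy').
Qed.

End Components.

(** * Undoing a slide *)

Section Slide.
Variables (n : nat) (T : stable_tree n) (i : label n).
Variables (v : vertex T) (B : {set {set vertex T}}).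
Let Br_a := component v (leaf T label_a).
Hypotheses (iv : edge T (leaf T i) v) (sB : B \subset branches v i).
Hypothesis aB : Br_a \in B.
Let S := slide_graph v B.

Let T_sym : symmetric (edge T).
Proof. by case: (tree_stable T) => -[]. Qed.

Let T_irr : irreflexive (edge T).
Proof. by case: (tree_stable T) => -[]. Qed.

Let T_conn x y : connect (edge T) x y.
Proof. by case: (tree_stable T) => -[]. Qed.

Lemma branch_component C : C \in B -> exists2 x, x != v & C = component v x.
Proof.
move/(subsetP sB); rewrite inE => /andP[_ /imsetP[x]].
by rewrite !inE; exists x.
Qed.

(** The leaf [i] has no neighbour other than [v], so its component is the
    singleton that is excluded from the branches. *)
Lemma leaf_notin_branch C : C \in B -> leaf T i \notin C.
Proof.
move=> CB; apply/negP=> iC; have [x _ Cx] := branch_component CB.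
have := subsetP sB _ CB; rewrite inE => /andP[/negP nC _]; apply: nC.
rewrite Cx in iC *; rewrite (component_eq T_sym iC).
have i_v : leaf T i != v by apply: contraTneq iv => ->; rewrite T_irr.
rewrite inE; apply/eqP/component_pendant => //.
by case: (tree_stable T) => _ _ degP _ _; apply/degP; exists i.
Qed.

(** If [v] were the leaf [a], then [Br_a] would be empty, whereas branches
    contain their base points. *)
Lemma leaf_a_neq : leaf T label_a != v.
Proof.
have [x xv ax] := branch_component aB.
have : x \in Br_a by rewrite ax inE xv connect0.
rewrite inE xv /=; apply: contraTneq => ->; apply/connectP=> -[[|z p]] /=.
  by move=> _ xE; rewrite xE eqxx in xv.
by rewrite /edge_avoiding /= eqxx andbF.
Qed.

Lemma slide_neighbour_leaf (p : vertex S) :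
  edge S (leaf S i) p = (p == Some v).
Proof.
have iB : is_root_in v B (leaf T i) = false.
  apply/negP=> /andP[_ /existsP[C /andP[/leaf_notin_branch/negP]]].
  by [].
have i_v : leaf T i == v = false.
  by apply: contraTF iv => /eqP->; rewrite T_irr.
have di : degree (leaf T i) = 1.
  by case: (tree_stable T) => _ _ degP _ _; apply/degP; exists i.
have [w iw] : exists w, neighbours (leaf T i) = [set w] by apply/cards1P/eqP.
have nbr y : edge T (leaf T i) y = (y == w).
  by have /setP/(_ y) := iw; rewrite !inE.
case: p => [y|] /=; rewrite ?i_v iB //= andbF andbT nbr.
by have := iv; rewrite nbr => /eqP->.
Qed.

(** The set of vertices lying in the moved branches, together with the new
    vertex, contains the leaf [a] and is closed under the edges that avoid
    [v]. *)
Lemma slide_reach_moved (p : vertex S) :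
    connect (@edge_avoiding n S (Some v)) (leaf S label_a) p ->
  if p is Some y then [exists C in B, y \in C] else true.
Proof.
pose moved (q : vertex S) :=
  if q is Some y then [exists C in B, y \in C] else true.
rewrite -/(moved p); have : moved (leaf S label_a).
  by apply/existsP; exists Br_a; rewrite aB inE leaf_a_neq connect0.
move: (leaf S label_a) => q q_m /connectP[s qs ->].
elim: s q q_m qs => [|q' s IHs] q //= q_m /andP[/and3P[qq' _ q'v]].
apply: IHs; case: q' q'v qq' => [y|] // yv; case: q q_m => [x|] //=.
  move=> /existsP[C /andP[CB xC]] /and3P[xy _ _].
  apply/existsP; exists C; rewrite CB /=.
  have [z _ Cz] := branch_component CB; rewrite Cz in xC *.
  by apply: component_step xC xy _; apply: contraNneq yv => ->.
by move=> _ /orP[yE|/andP[]//]; case/negP: yv; rewrite (eqP yE).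
Qed.

(** The leaf [a] reaches the new vertex through the root of [Br_a].  A
    neighbour of [v] in a moved branch is the root of that branch, and the slide
    has detached it from [v]; so no old vertex has the same property. *)
Lemma slide_neighbour_towards (p : vertex S) :
  edge S (Some v) p &&
    connect (@edge_avoiding n S (Some v)) (leaf S label_a) p = (p == None).
Proof.
apply/andP/eqP=> [[vp /slide_reach_moved]|->].
  case: p vp => [y|] //= /and3P[vy]; rewrite eqxx /= => /negP yB _ yC.
  by case: yB; rewrite /is_root_in vy.
rewrite /= eqxx; split=> //.
have [r ra vr] := component_root T_sym (T_conn (leaf T label_a) v) leaf_a_neq.
move: (ra); rewrite inE => /andP[r_v ar].
apply: (@connect_trans _ _ (Some r)).
  (* The walk from a to the root r stays within T minus v, where the slide
     changes no edge. *)
  case/connectP: ar => s; rewrite /=; move: (leaf T label_a) => x.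
  elim: s x => [|y s IHs] x /=; first by move=> _ ->; rewrite connect0.
  case/andP=> /and3P[xy x_v y_v] ys rE; apply: connect_trans (IHs y ys rE).
  apply: connect1; rewrite /edge_avoiding /= xy (negbTE x_v) (negbTE y_v) /=.
  by rewrite !(inj_eq Some_inj) x_v y_v.
apply: connect1; rewrite /edge_avoiding /= (inj_eq Some_inj) r_v /= andbT.
apply/orP; right; rewrite /is_root_in vr.
by apply/existsP; exists Br_a; rewrite aB.
Qed.

(** The neighbours of [v] in [T] are those that it keeps together with those
    of the new vertex; the edge between [v] and the new vertex must not become a
    loop. *)
Lemma slide_contraction (x y : vertex T) :
  edge T x y = [|| edge S (Some x) (Some y),
                   [&& x == v, y != v & edge S None (Some y)]
                 | [&& y == v, x != v & edge S None (Some x)]].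
Proof.
have rootE z : edge T v z = (edge T v z && ~~ is_root_in v B z)
    || is_root_in v B z.
  rewrite /is_root_in; case: (edge T v z) => //=.
  by rewrite orbC orbN.
rewrite /=; have [->|_] := eqVneq x v; have [->|_] := eqVneq y v.
- by rewrite T_irr.
- by rewrite /= andbT orbF {1}rootE.
- by rewrite /= [edge T x v]T_sym {1}rootE.
- by rewrite /= andbT orbF.
Qed.

End Slide.

(** The isomorphism of the results matches the neighbours of the leaves [i]
    and the new vertices because it respects the descriptions of these two
    vertices by leaves and adjacency, so it restricts to the old vertices and
    commutes with the contraction. *)
Lemma slide_graph_inj n (i : label n) (T T' : stable_tree n)
    (v : vertex T) (B : {set {set vertex T}})
    (v' : vertex T') (B' : {set {set vertex T'}}) :
    edge T (leaf T i) v -> B \subset branches v i ->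
    component v (leaf T label_a) \in B ->
    edge T' (leaf T' i) v' -> B' \subset branches v' i ->
    component v' (leaf T' label_a) \in B' ->
  isomorphic (slide_graph v B) (slide_graph v' B') -> isomorphic T T'.
Proof.
move=> iv sB aB iv' sB' aB' [g [[g' gK g'K] gE gL]].
have g_inj := can_inj gK.
have gv : g (Some v) = Some v'.
  apply/eqP; rewrite -(slide_neighbour_leaf iv' sB') -gL gE.
  by rewrite (slide_neighbour_leaf iv sB).
have gN : g None = None.
  apply/eqP; rewrite -(slide_neighbour_towards sB' aB') -gv gE -gL.
  have /andP[-> aN] : edge (slide_graph v B) (Some v) None &&
      connect (@edge_avoiding n (slide_graph v B) (Some v))
        (leaf (slide_graph v B) label_a) None.
    by rewrite (slide_neighbour_towards sB aB).
  exact: connect_avoiding_image aN.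
have g'N : g' None = None by rewrite -gN gK.
(* As g and g' send None to None, they send old vertices to old vertices. *)
pose h x := odflt v' (g (Some x)); pose h' x := odflt v (g' (Some x)).
have hE x : Some (h x) = g (Some x).
  rewrite /h; case gx: (g (Some x)) => [//|].
  by have := gK (Some x); rewrite gx g'N.
have h'E x : Some (h' x) = g' (Some x).
  rewrite /h'; case gx: (g' (Some x)) => [//|].
  by have := g'K (Some x); rewrite gx gN.
have hv x : (h x == v') = (x == v).
  by rewrite -(inj_eq Some_inj) hE -gv (inj_eq g_inj) (inj_eq Some_inj).
exists h; split.
- by exists h' => x; apply: Some_inj; rewrite ?h'E ?hE ?h'E ?gK ?g'K.
- move=> x y; rewrite (slide_contraction v' B') (slide_contraction v B).
  by rewrite !hv !hE -gN !gE.
- by move=> k; apply: Some_inj; rewrite hE; apply: gL.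
Qed.

(** * Disjointness of slide sets *)

Theorem lemma1p3 (n : nat) (hn : 1 <= n) (T T' : stable_tree n)
    (hTT' : ~ isomorphic T T') (i : nat) (hi : 1 <= i <= n) :
  forall X : stable_tree n,
    ~ (slide (label_num i) T X /\ slide (label_num i) T' X).
Proof.
move=> X [[v [m [B [iv _ sB /andP[aB _] isoX]]]]].
move=> [v' [m' [B' [iv' _ sB' /andP[aB' _] isoX']]]].
apply: hTT'; apply: (slide_graph_inj iv sB aB iv' sB' aB').
exact: isomorphic_trans isoX (isomorphic_sym isoX').
Qed.
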